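(* Let $b\ge 2$ be an integer, let $\xi\neq 1$ be a complex number with $\xi^b=1$, let $r\ge 1$ and let $N_1,\dots,N_r$ be positive integers. Then for all $x,y_1,\dots,y_r\in\mathbb{C}$, $$\sum_{n_{1}=0}^{b^{N_{1}}-1}\cdots\sum_{n_{r}=0}^{b^{N_{r}}-1}\xi^{\sum_{j=1}^{r}s_{b}(n_{j})}\Big(x+\sum_{j=1}^{r}n_{j}y_{j}\Big)^{\sum_{j=1}^{r}N_{j}}=\left(\frac{1}{\xi-1}\right)^{\sum_{j=1}^{r}N_{j}}b^{\sum_{j=1}^{r}\frac{N_{j}(N_{j}+1)}{2}}\left(\prod_{j=1}^{r}y_{j}^{N_{j}}\right)\Big(\sum_{j=1}^{r}N_{j}\Big)!.$$ In particular (case $b=2$, $\xi=-1$), $$\sum_{n_{1}=0}^{2^{N_{1}}-1}\cdots\sum_{n_{r}=0}^{2^{N_{r}}-1}(-1)^{\sum_{j=1}^{r}s_{2}(n_{j})}\Big(x+\sum_{j=1}^{r}n_{j}y_{j}\Big)^{\sum_{j=1}^{r}N_{j}}=(-1)^{\sum_{j=1}^{r}N_{j}}2^{\sum_{j=1}^{r}\frac{N_{j}(N_{j}-1)}{2}}\left(\prod_{j=1}^{r}y_{j}^{N_{j}}\right)\Big(\sum_{j=1}^{r}N_{j}\Big)!.$$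
   Context: For a nonnegative integer $n$ and an integer $b\ge2$, $s_b(n)$ denotes the sum of the digits of $n$ in base $b$. *)

(* Defs.v *)
From mathcomp Require Import all_boot all_order all_algebra.
From mathcomp Require Import reals complex.

Set Implicit Arguments.
Unset Strict Implicit.
Unset Printing Implicit Defensive.

(* For b >= 2 the base-b digits of n > 0 sit at positions 0 .. trunc_log b n
   (the floor of the base-b logarithm); for n = 0 the only position is 0. *)
Definition digit_sum (b n : nat) : nat :=
  \sum_(i < (trunc_log b n).+1) (n %/ b ^ i) %% b.

(* Main.v *)
Require Import Defs.
From mathcomp Require Import all_boot all_order all_algebra.
From mathcomp Require Import reals complex.
From mathcomp Require Import ring.

Set Implicit Arguments.
Unset Strict Implicit.
Unset Printing Implicit Defensive.

Import Order.TTheory GRing.Theory Num.Theory.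
Local Open Scope ring_scope.
Local Open Scope complex_scope.

(** Write [M] for the sum of the [N j].  The number [c ^+ M / M`!] is the
    coefficient of [t^M] in the exponential series [exp(c t)], so the left-hand
    side divided by [M`!] is the coefficient of [t^M] in the sum over all [n] of
    [xi^(s(n_1) + ... + s(n_r)) exp((x + n_1 y_1 + ... + n_r y_r) t)].
    Since the exponential turns sums into products, this series is
    [exp(x t) * \prod_j D_j(t)], where [D_j(t)] is the sum over
    [n < b ^ N j] of [xi^(s n) exp(n y_j t)] (the distributivity is
    [bigA_distr_dffun]).

    The digit sum is additive along base-[b] expansions, so [D_j] in turn
    factors over digit positions into [N j] series of the form
    [\sum_(a < b) xi^a exp(a h t)], with [h = b^i y_j] for [i < N j]
    ([digit_sum_expS] splits off one digit).  As [xi] is a nontrivial [b]-th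
    root of unity, such a series has no constant term, and its coefficient of
    [t] is [h \sum_a a xi^a = b h / (xi - 1)]
    ([lowest_term_one_digit_exp]).  Altogether there are [M] such factors, so
    the product starts at [t^M], and its coefficient there is simply the product
    of the leading coefficients: [1 / (xi - 1)] contributes the power [M], and
    the powers of [b] collected for a given [j] are [1 + 2 + ... + N j].

    Formal power series are represented by polynomials whose coefficients only
    matter up to degree [M]: [exp_poly M c] is the truncated exponential,
    [eq_upto M] is congruence modulo [t^(M+1)], and [lowest_term v c p] says
    that [p] is congruent to [c t^v] modulo [t^(v+1)].  The argument needs to
    divide by factorials, and takes place in any [numFieldType]. *)

(** * Digit sums *)

(** The digits at positions beyond the leading one are all zero, so the number of
    positions taken into account is irrelevant as soon as it is large enough. *)
Lemma digit_sum_widen b n K : (1 < b)%N -> (n < b ^ K)%N ->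
  digit_sum b n = (\sum_(i < K) (n %/ b ^ i) %% b)%N.
Proof.
move=> b1 nK.
have widen L L' : (n < b ^ L)%N -> (L <= L')%N ->
    (\sum_(i < L') (n %/ b ^ i) %% b = \sum_(i < L) (n %/ b ^ i) %% b)%N.
  move=> nL leLL'.
  rewrite [RHS](big_ord_widen L' (fun i => (n %/ b ^ i) %% b)%N leLL').
  rewrite [RHS]big_mkcond; apply: eq_bigr => i _; case: ltnP => // leLi.
  by rewrite divn_small ?mod0n // (leq_trans nL) // leq_exp2l.
have nT := trunc_log_ltn n b1.
by rewrite /digit_sum -(widen _ _ nT (leq_maxl _ K)) (widen _ _ nK) // leq_maxr.
Qed.

Lemma digit_sum_addMn b m a : (1 < b)%N -> (a < b)%N ->
  digit_sum b (m * b + a) = (a + digit_sum b m)%N.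
Proof.
move=> b1 ab.
have b0 : (0 < b)%N by apply: ltn_trans b1.
(* [m] is a crude bound for the number of digits of [m]. *)
have mK : (m < b ^ m)%N by apply: ltn_expl.
rewrite (digit_sum_widen b1 mK) (@digit_sum_widen _ _ m.+1) //; last first.
  rewrite expnSr; apply: (@leq_trans (m.+1 * b)); last by rewrite leq_mul2r mK orbT.
  by rewrite mulSn addnC ltn_add2r.
rewrite big_ord_recl divn1 modnMDl modn_small //; congr addn.
apply: eq_bigr => i _.
by rewrite /= /bump add1n expnS divnMA divnMDl // (divn_small ab) addn0.
Qed.

(** * Sums over roots of unity *)

Lemma sum_unity_root_expr (F : fieldType) (xi : F) n : xi != 1 -> xi ^+ n = 1 ->
  \sum_(a < n) xi ^+ a = 0.
Proof.
move=> xi1 xin; have := subrX1 xi n; rewrite xin subrr => /esym/eqP.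
by rewrite mulf_eq0 subr_eq0 (negPf xi1) => /eqP.
Qed.

(** Abel summation: multiplying by [xi - 1] turns the weights [a] into their
    differences, which leaves the boundary term [n] and a vanishing geometric
    sum. *)
Lemma sum_unity_root_expr_nat (F : fieldType) (xi : F) n : xi != 1 -> xi ^+ n = 1 ->
  \sum_(a < n) xi ^+ a * a%:R = n%:R / (xi - 1).
Proof.
move=> xi1 xin.
have step m : (xi - 1) * (\sum_(a < m) xi ^+ a * a%:R)
    = m%:R * xi ^+ m - xi * \sum_(a < m) xi ^+ a.
  elim: m => [|m IHm]; first by rewrite !big_ord0 mul0r !mulr0 subrr.
  by rewrite !big_ord_recr /= !mulrDr IHm exprS; ring.
have nz : xi - 1 != 0 by rewrite subr_eq0.
apply: (mulfI nz); rewrite step sum_unity_root_expr // xin.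
by rewrite mulr0 subr0 mulr1 mulrC divfK.
Qed.

(** * Distributivity over dependent finite functions *)

(** The index type of the inner sum depends on the factor.  Embedding all the
    [T i] into the tagged union reduces this to [bigA_distr_big_dep], where
    every inner sum ranges over a part of a common type. *)
Lemma bigA_distr_dffun (R : comPzSemiRingType) (I : finType) (T : I -> finType)
    (G : forall i, T i -> R) :
  \prod_i \sum_(t : T i) G i t
    = \sum_(f : {dffun forall i, T i}) \prod_i G i (f i).
Proof.
rewrite (reindex (@dffun_of_fprod _ T)); last exact/onW_bij/dffun_of_fprod_bij.
transitivity (\sum_(t : fprod T) \prod_i [ffun u => G i u] (t i)); last first.
  by apply: eq_bigr => t _; apply: eq_bigr => i _; rewrite !ffunE.
rewrite big_fprod; under eq_bigr do rewrite (big_tag G).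
rewrite bigA_distr_big_dep; apply: eq_bigr => g _; apply: eq_bigr => i _.
by rewrite /untag; case: eqP => // ?; rewrite ffunE.
Qed.

(** * Polynomials as truncated power series *)

Definition eq_upto (R : nzSemiRingType) (M : nat) (p q : {poly R}) :=
  forall k, (k <= M)%N -> p`_k = q`_k.

Lemma eq_uptoM (R : nzSemiRingType) M (p p' q q' : {poly R}) :
  eq_upto M p p' -> eq_upto M q q' -> eq_upto M (p * q) (p' * q').
Proof.
move=> pp' qq' k kM; rewrite !coefM; apply: eq_bigr => i _.
have ik : (i <= k)%N by rewrite -ltnS.
by rewrite pp' ?qq' // (leq_trans _ kM) // leq_subr.
Qed.

(** Both [v] and [c] are part of the data, and [c] may vanish: the valuation of [p] is
    only bounded below by [v].  This is what makes the notion multiplicative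
    without any condition on the coefficient ring. *)
Definition lowest_term (R : nzSemiRingType) v (c : R) (p : {poly R}) :=
  forall k, (k <= v)%N -> p`_k = if k == v then c else 0.

Lemma lowest_termM (R : nzSemiRingType) v w (c d : R) p q :
  lowest_term v c p -> lowest_term w d q -> lowest_term (v + w) (c * d) (p * q).
Proof.
move=> hp hq k kvw; rewrite coefM.
(* As [k <= v + w], either [i < v] or [k - i < w], where a factor vanishes, or else
   [i = v] and [k - i = w]. *)
have term (i : nat) : (i <= k)%N ->
    p`_i * q`_(k - i) = if (i == v) && (k - i == w)%N then c * d else 0.
  move=> ik; case: (leqP i v) => iv.
    rewrite hp //; case: eqVneq => [->|nv] /=; last by rewrite mul0r.
    by rewrite hq ?leq_subLR //; case: eqP => // _; rewrite mulr0.
  rewrite (gtn_eqF iv) /= hq ?ltn_eqF ?mulr0 //.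
  - by rewrite ltn_subLR // (leq_ltn_trans kvw) // ltn_add2r.
  - by rewrite leq_subLR (leq_trans kvw) // leq_add2r ltnW.
rewrite (eq_bigr (fun i : 'I_k.+1 =>
  if (i == v :> nat) && (k - i == w)%N then c * d else 0)); last first.
  by move=> i _; apply: term; rewrite -ltnS.
case: eqVneq => [kE|kN].
  have vk : (v < k.+1)%N by rewrite kE ltnS leq_addr.
  rewrite (bigD1 (Ordinal vk)) //= {1}kE addKn !eqxx big1 ?addr0 // => i.
  by rewrite -val_eqE /= => /negPf->.
apply: big1 => i _; case: andP => // -[/eqP iv /eqP kw].
by case/eqP: kN; rewrite -iv -kw subnKC // -ltnS.
Qed.

Lemma lowest_term_prod (R : comNzSemiRingType) (I : Type) (s : seq I) (v : I -> nat)
    (c : I -> R) (p : I -> {poly R}) :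
  (forall i, lowest_term (v i) (c i) (p i)) ->
  lowest_term (\sum_(i <- s) v i) (\prod_(i <- s) c i) (\prod_(i <- s) p i).
Proof.
move=> h; elim: s => [|i s IHs]; last by rewrite !big_cons; apply: lowest_termM.
by rewrite !big_nil => k; rewrite leqn0 => /eqP->; rewrite coefC.
Qed.

Lemma eq_upto_lowest_term (R : nzSemiRingType) M v (c : R) p q : (v <= M)%N ->
  eq_upto M p q -> lowest_term v c q -> lowest_term v c p.
Proof. by move=> vM pq hq k kv; rewrite pq ?hq // (leq_trans kv). Qed.

(** * Truncated exponentials *)

Definition exp_poly (F : fieldType) (M : nat) (c : F) : {poly F} :=
  \poly_(k < M.+1) (c ^+ k / k`!%:R).

Lemma coef_exp_poly (F : fieldType) M (c : F) k : (k <= M)%N ->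
  (exp_poly M c)`_k = c ^+ k / k`!%:R.
Proof. by move=> kM; rewrite coef_poly ltnS kM. Qed.

(** The binomial theorem, divided by [k`!]. *)
Lemma exp_polyD (F : numFieldType) M (c d : F) :
  eq_upto M (exp_poly M (c + d)) (exp_poly M c * exp_poly M d).
Proof.
move=> k kM; rewrite coef_exp_poly // coefM addrC exprDn mulr_suml.
apply: eq_bigr => i _.
have ik : (i <= k)%N by rewrite -ltnS.
rewrite !coef_exp_poly ?(leq_trans _ kM) ?leq_subr //.
have nz m : m`!%:R != 0 :> F by rewrite pnatr_eq0 -lt0n fact_gt0.
rewrite -mulr_natr -(bin_fact ik) !natrM; field.
by rewrite !nz pnatr_eq0 -lt0n bin_gt0 ik.
Qed.

Lemma exp_poly0 (F : fieldType) M : exp_poly M (0 : F) = 1.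
Proof.
apply/polyP => -[|k]; rewrite coef_poly coefC /=; first by rewrite divr1.
by rewrite expr0n mul0r if_same.
Qed.

Lemma exp_poly_sum (F : numFieldType) M (I : Type) (s : seq I) (c : I -> F) :
  eq_upto M (exp_poly M (\sum_(i <- s) c i)) (\prod_(i <- s) exp_poly M (c i)).
Proof.
elim: s => [|i s IHs]; first by rewrite !big_nil exp_poly0.
rewrite !big_cons => k kM; rewrite exp_polyD //.
by apply: eq_uptoM kM => // ?.
Qed.

(** * Exponential sums weighted by the digit sum *)

Definition digit_sum_exp (F : fieldType) b (xi : F) M N (y : F) : {poly F} :=
  \sum_(n < b ^ N) xi ^+ digit_sum b n *: exp_poly M (n%:R * y).

Definition one_digit_exp (F : fieldType) b (xi : F) M (y : F) : {poly F} :=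
  \sum_(a < b) xi ^+ a *: exp_poly M (a%:R * y).

(** The coefficients in degrees 0 and 1 are the sums of [xi ^+ a] and of
    [a * xi ^+ a], up to the factor [y] in the second one. *)
Lemma lowest_term_one_digit_exp (F : fieldType) b (xi : F) M (y : F) :
  xi != 1 -> xi ^+ b = 1 -> (0 < M)%N ->
  lowest_term 1 (b%:R * y / (xi - 1)) (one_digit_exp b xi M y).
Proof.
move=> xi1 xib M0 k k1; rewrite coef_sum.
transitivity (\sum_(a < b) xi ^+ a * ((a%:R * y) ^+ k / k`!%:R)).
  by apply: eq_bigr => a _; rewrite coefZ coef_exp_poly // (leq_trans k1).
case: k k1 => [|[|//]] _ /=.
  by under eq_bigr do rewrite expr0 divr1 mulr1; apply: sum_unity_root_expr.
under eq_bigr do rewrite expr1 divr1 mulrA.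
by rewrite -mulr_suml sum_unity_root_expr_nat // mulrAC.
Qed.

(** Splitting off the lowest digit: every [n < b ^ N.+1] is [m * b + a] with [a < b]
    and [m < b ^ N], and [exp(n y t) = exp(a y t) exp(m (b y) t)]. *)
Lemma digit_sum_expS (F : numFieldType) b (xi : F) M N (y : F) : (1 < b)%N ->
  eq_upto M (digit_sum_exp b xi M N.+1 y)
    (one_digit_exp b xi M y * digit_sum_exp b xi M N (b%:R * y)).
Proof.
move=> b1 k kM.
rewrite /digit_sum_exp expnSr.
rewrite -(big_mkord xpredT (fun n => xi ^+ digit_sum b n *: exp_poly M (n%:R * y))).
rewrite big_nat_mul big_mkord mulr_sumr !coef_sum; apply: eq_bigr => m _.
rewrite -{1}[(m * b)%N]add0n big_addn mulSn addnK big_mkord mulr_suml !coef_sum.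
apply: eq_bigr => a _.
rewrite addnC digit_sum_addMn // -scalerAl -scalerAr scalerA -exprD !coefZ.
by rewrite -exp_polyD // natrD natrM mulrDl mulrA addrC.
Qed.

(** Each digit contributes one factor starting in degree 1.  The step sizes are
    [y, b y, ..., b^(N-1) y], and each factor carries one more [b], so that the exponent
    of [b] is [1 + ... + N], the binomial coefficient ['C(N.+1, 2)]. *)
Lemma lowest_term_digit_sum_exp (F : numFieldType) b (xi : F) M N (y : F) :
  (1 < b)%N -> xi != 1 -> xi ^+ b = 1 -> (N <= M)%N ->
  lowest_term N ((1 / (xi - 1)) ^+ N * b%:R ^+ 'C(N.+1, 2) * y ^+ N)
    (digit_sum_exp b xi M N y).
Proof.
move=> b1 xi1 xib; elim: N y => [|N IHN] y NM.
  move=> k; rewrite leqn0 => /eqP->; rewrite /digit_sum_exp big_ord1.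
  rewrite coefZ coef_exp_poly // /digit_sum trunc_log0 big_ord1 div0n mod0n.
  by rewrite !expr0 divr1 !mulr1.
apply: (eq_upto_lowest_term NM (digit_sum_expS xi N y b1)).
have -> : (1 / (xi - 1)) ^+ N.+1 * b%:R ^+ 'C(N.+2, 2) * y ^+ N.+1 =
  b%:R * y / (xi - 1) *
  ((1 / (xi - 1)) ^+ N * b%:R ^+ 'C(N.+1, 2) * (b%:R * y) ^+ N).
  by rewrite (binS N.+1 1) bin1 (exprMn _ _ y) exprD !exprS; ring.
rewrite -add1n; apply: lowest_termM; last exact/IHN/ltnW.
by apply: lowest_term_one_digit_exp => //; apply: leq_trans NM.
Qed.

(** * The power sums *)

(** The factors of the generating function have valuations [0, N 0, ..., N (r-1)], which
    add up to the degree [M] at which the coefficient is read off: only the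
    lowest terms contribute, and [x] disappears from the result. *)
Lemma sum_digit_sum_power (F : numFieldType) b (xi : F) r (N : 'I_r -> nat)
    (x : F) (y : 'I_r -> F) : (1 < b)%N -> xi != 1 -> xi ^+ b = 1 ->
  \sum_(n : {dffun forall j : 'I_r, 'I_(b ^ N j)})
     xi ^+ (\sum_(j < r) digit_sum b (n j))
     * (x + \sum_(j < r) (n j)%:R * y j) ^+ (\sum_(j < r) N j)
  = (1 / (xi - 1)) ^+ (\sum_(j < r) N j)
    * b%:R ^+ (\sum_(j < r) 'C((N j).+1, 2))
    * (\prod_(j < r) y j ^+ N j)
    * ((\sum_(j < r) N j)`!)%:R.
Proof.
move=> b1 xi1 xib; set M := (\sum_(j < r) N j)%N.
have hx : lowest_term 0 1 (exp_poly M x).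
  by move=> k; rewrite leqn0 => /eqP->; rewrite coef_exp_poly // divr1.
have NM j : (N j <= M)%N by rewrite /M (bigD1 j) //= leq_addr.
have hp := lowest_term_prod (s := index_enum 'I_r)
  (fun j => @lowest_term_digit_sum_exp F b xi M (N j) (y j) b1 xi1 xib (NM j)).
have lead_coefE := lowest_termM hx hp (leqnn _).
rewrite add0n eqxx mul1r !big_split !prodrXr -/M in lead_coefE; rewrite -lead_coefE.
rewrite /digit_sum_exp bigA_distr_dffun mulr_sumr coef_sum mulr_suml.
apply: eq_bigr => n _.
rewrite scaler_prod prodrXr -scalerAr coefZ -mulrA; congr (_ * _).
have fz : M`!%:R != 0 :> F by rewrite pnatr_eq0 -lt0n fact_gt0.
apply: (mulIf (invr_neq0 fz)); rewrite mulfK // -(@coef_exp_poly _ M) // exp_polyD //.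
exact: eq_uptoM (exp_poly_sum _ _) _ _.
Qed.

(** It remains to rewrite the exponents.  For [b = 2] and [xi = -1], the factor
    [1 / (xi - 1) = - 1 / 2] lowers the exponent of [2] by [N j] for each
    [j]: this is Pascal's rule ['C(N.+1, 2) = 'C(N, 2) + N]. *)
Theorem proposition12 (R : realType) (r : nat) (hr : (1 <= r)%N)
    (N : 'I_r -> nat) (hN : forall j, (0 < N j)%N)
    (x : R[i]) (y : 'I_r -> R[i]) :
  (forall (b : nat) (xi : R[i]), (2 <= b)%N -> xi != 1 -> xi ^+ b = 1 ->
    \sum_(n : {dffun forall j : 'I_r, 'I_(b ^ N j)})
       xi ^+ (\sum_(j < r) digit_sum b (n j))
       * (x + \sum_(j < r) (n j)%:R * y j) ^+ (\sum_(j < r) N j)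
    = (1 / (xi - 1)) ^+ (\sum_(j < r) N j)
      * b%:R ^+ (\sum_(j < r) (N j * (N j + 1)) %/ 2)
      * (\prod_(j < r) y j ^+ N j)
      * ((\sum_(j < r) N j)`!)%:R)
  /\
  \sum_(n : {dffun forall j : 'I_r, 'I_(2 ^ N j)})
     (-1) ^+ (\sum_(j < r) digit_sum 2 (n j))
     * (x + \sum_(j < r) (n j)%:R * y j) ^+ (\sum_(j < r) N j)
  = (-1) ^+ (\sum_(j < r) N j)
    * 2%:R ^+ (\sum_(j < r) (N j * (N j - 1)) %/ 2)
    * (\prod_(j < r) y j ^+ N j)
    * ((\sum_(j < r) N j)`!)%:R.
Proof.
split=> [b xi b2 xi1 xib|].
  rewrite sum_digit_sum_power //; congr (_ * _ ^+ _ * _ * _).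
  by apply: eq_bigr => j _; rewrite bin2 divn2 addn1 mulnC.
have m1 : -1 != 1 :> R[i] by rewrite -subr_eq0 -opprD oppr_eq0 (pnatr_eq0 _ 2).
rewrite sum_digit_sum_power ?sqrrN ?expr1n //; congr (_ * _ * _).
have -> : (\sum_(j < r) 'C((N j).+1, 2) =
    \sum_(j < r) N j + \sum_(j < r) (N j * (N j - 1)) %/ 2)%N.
  rewrite -big_split; apply: eq_bigr => j _ /=.
  by rewrite (binS _ 1) bin1 addnC bin2 divn2 subn1.
rewrite exprD mulrA -exprMn; congr (_ ^+ _ * _).
have n2 : 2%:R != 0 :> R[i] by rewrite pnatr_eq0.
by rewrite -opprD div1r invrN mulNr mulVf.
Qed.
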